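(* Let $\alpha,\beta\ge 0$ with $(\alpha,\beta)\neq(0,0)$, and let $\mathbf{T}=(T_1,\dots,T_n)$ and $\mathbf{S}=(S_1,\dots,S_n)$ be in $\mathcal{B}_{A^{1/2}}(\mathcal{H})^n$. Then: (i) $\|\mathbf{T}\|_{A_{\alpha,\beta}}=0$ if and only if $AT_k=0$ for all $k=1,\dots,n$. (ii) $\|\lambda\mathbf{T}\|_{A_{\alpha,\beta}}=|\lambda|\,\|\mathbf{T}\|_{A_{\alpha,\beta}}$ for all $\lambda\in\mathbb{C}$. (iii) $\|\mathbf{T}+\mathbf{S}\|_{A_{\alpha,\beta}}\le\|\mathbf{T}\|_{A_{\alpha,\beta}}+\|\mathbf{S}\|_{A_{\alpha,\beta}}$.
   Context: $\mathcal{H}$ is a non-trivial complex Hilbert space, $\mathcal{B}(\mathcal{H})$ the bounded linear operators on it, $A\in\mathcal{B}(\mathcal{H})$ a fixed positive operator ($\langle Ax,x\rangle\ge0$ for all $x$), $n\ge 1$ an integer. Put $\langle x,y\rangle_A=\langle Ax,y\rangle$ and $\|x\|_A=\langle Ax,x\rangle^{1/2}$. $\mathcal{B}_{A^{1/2}}(\mathcal{H})$ is the set of $T\in\mathcal{B}(\mathcal{H})$ for which there is $c>0$ with $\|Tx\|_A\le c\|x\|_A$ for all $x\in\mathcal{H}$; $\mathcal{B}_{A^{1/2}}(\mathcal{H})^n$ is the set of $n$-tuples of such operators, with componentwise sum and scalar multiplication. For $\mathbf{T}\in\mathcal{B}_{A^{1/2}}(\mathcal{H})^n$, $$\|\mathbf{T}\|_{A_{\alpha,\beta}}=\sup\Big\{\Big(\sum_{k=1}^n\big(\alpha|\langle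 T_kx,x\rangle_A|^2+\beta\|T_kx\|_A^2\big)\Big)^{1/2}:x\in\mathcal{H},\ \|x\|_A=1\Big\}.$$ *)

(* Defs.v *)
From HB Require Import structures.
From mathcomp Require Import all_boot all_order all_algebra.
From mathcomp Require Import complex.
From mathcomp Require Import all_classical all_reals.
From mathcomp Require Import topology normedtype.

Set Implicit Arguments.
Unset Strict Implicit.
Unset Printing Implicit Defensive.

Import Order.TTheory GRing.Theory Num.Theory.
Import numFieldNormedType.Exports.

Local Open Scope classical_set_scope.
Local Open Scope ring_scope.
Local Open Scope complex_scope.

(* [{dot H for conj}] is linear in its first argument and conjugate-linear in
   its second one. *)
HB.mixin Record isHilbert (R : realType) H & CompleteNormedModule R[i] H := {
  inner : {dot H for @Num.conj R[i]};
  inner_norm : forall x : H, inner x x = `|x| ^+ 2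
}.

#[short(type="hilbertType")]
HB.structure Definition Hilbert (R : realType) :=
  { H of isHilbert R H & CompleteNormedModule R[i] H }.

Section operators.
Context {R : realType} {H : hilbertType R}.

Definition bounded_operators : set (H -> H) :=
  [set T | linear T /\ exists c : R, forall x, `|T x| <= c%:C * `|x|].

(* In the order of [R[i]], [0 <= z] says that [z] is real and nonnegative. *)
Definition positive_operator (A : H -> H) : Prop :=
  bounded_operators A /\ forall x, 0 <= inner (A x) x.

Variable A : H -> H.

Definition innerA (x y : H) : R[i] := inner (A x) y.

(* [innerA x x] is real when [A] is positive, so [Re] loses nothing; it only
   brings the value into [R]. *)
Definition normA (x : H) : R := Num.sqrt (complex.Re (innerA x x)).

Definition A_bounded_operators : set (H -> H) :=
  [set T | bounded_operators T /\
    exists2 c : R, 0 < c & forall x, normA (T x) <= c * normA x].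

(* [sup] is the real supremum. It is 0 on the empty set, which occurs only for
   [A = 0], and the set is bounded above when the [T k] are [A]-bounded.
   [Normc.normc] is the complex modulus with values in [R]. *)
Definition norm_ab (alpha beta : R) (n : nat) (T : 'I_n -> H -> H) : R :=
  sup [set Num.sqrt (\sum_(k < n) (alpha * Normc.normc (innerA (T k x) x) ^+ 2
                                   + beta * normA (T k x) ^+ 2))
      | x in [set x | normA x = 1]].

End operators.

(* Main.v *)
(* For each x, the quantity under the supremum is a weighted l^2 norm of the
   2n-tuple of the |<T_k x, x>_A| and ||T_k x||_A, and each of these entries is a
   seminorm in T by the Cauchy-Schwarz inequality for the positive form <., .>_A;
   homogeneity and the triangle inequality pass to the supremum, which is finite
   because the T_k are A-bounded. If the supremum vanishes, then <A T_k x, x> = 0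
   for all A-unit x, hence for all x, and A T_k = 0 by complex polarization. *)
Require Import Defs.
From HB Require Import structures.
From mathcomp Require Import all_boot all_order all_algebra.
From mathcomp Require Import complex.
From mathcomp Require Import all_classical all_reals.
From mathcomp Require Import topology normedtype.
From mathcomp Require Import ring.

Set Implicit Arguments.
Unset Strict Implicit.
Unset Printing Implicit Defensive.

Import Order.TTheory GRing.Theory Num.Theory.
Import numFieldNormedType.Exports.
Local Open Scope classical_set_scope.
Local Open Scope ring_scope.

(** Polarization: the diagonal at [x + y] makes [f] antisymmetric, the one at ['i *: x + y] makes it
    symmetric. *)
Lemma sesquilinear_eq0 (C : numClosedFieldType) (V : lmodType C)
    (f : V -> V -> C) :
  (forall a x y z, f (a *: x + y) z = a * f x z + f y z) ->
  (forall a x y z, f x (a *: y + z) = a^* * f x y + f x z) ->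
  (forall x, f x x = 0) -> forall x y, f x y = 0.
Proof.
move=> fl fr f0 x y.
have sym0 : f x y + f y x = 0.
  have := f0 (1 *: x + y).
  by rewrite fl !fr !f0 conjC1 !mul1r add0r addr0.
have /eqP : 'i * (f x y - f y x) = 0.
  have := f0 ('i *: x + y).
  rewrite fl !fr !f0 conjCi => <-; ring.
rewrite mulf_eq0 (negPf (neq0Ci _))/= => /eqP fB0.
have /eqP : f x y *+ 2 = 0 by rewrite -[RHS](addr0 0) -{1}sym0 -fB0; ring.
by rewrite mulrn_eq0 => /eqP.
Qed.

(** * Positive semidefinite sesquilinear forms *)

Section positive_sesquilinear.
Context {C : numClosedFieldType} {V : lmodType C}.
Variable f : V -> V -> C.
Hypothesis f_linearl : forall a x y z, f (a *: x + y) z = a * f x z + f y z.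
Hypothesis f_linearr : forall a x y z, f x (a *: y + z) = a^* * f x y + f x z.
Hypothesis f_ge0 : forall x, 0 <= f x x.

(* [f x y - (f y x)^*] is sesquilinear and zero on the diagonal. *)
Lemma sesquilinear_ge0_herm x y : f y x = (f x y)^*.
Proof.
apply/eqP; rewrite -subr_eq0; apply/eqP; move: y x.
apply: (@sesquilinear_eq0 _ _ (fun u v => f u v - (f v u)^*)).
- by move=> a x y z; rewrite f_linearl f_linearr rmorphD rmorphM/= conjCK; ring.
- by move=> a x y z; rewrite f_linearl f_linearr rmorphD rmorphM; ring.
- by move=> x; rewrite conj_Creal ?subrr// ger0_real.
Qed.

Let f_comb a b x y : f (a *: x + b *: y) (a *: x + b *: y) =
  `|a| ^+ 2 * f x x + (a * b^* * f x y + (a * b^* * f x y)^*)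
  + `|b| ^+ 2 * f y y.
Proof.
have fZ c u v : f u (c *: v) = c^* * f u v.
  have f0 : f u 0 = 0.
    have := f_linearr 1 u 0 0; rewrite scale1r addr0 conjC1 mul1r.
    by rewrite -[LHS]addr0 => /addrI.
  by rewrite -[c *: v]addr0 f_linearr f0 addr0.
have fZl c u v : f (c *: u) v = c * f u v.
  by rewrite sesquilinear_ge0_herm fZ rmorphM/= conjCK -sesquilinear_ge0_herm.
rewrite f_linearl !f_linearr !fZl !fZ !normCK [f y x]sesquilinear_ge0_herm.
rewrite !rmorphM/= conjCK; ring.
Qed.

(** If [f v v > 0], the nonnegative value of the form at [f v v *: u - f u v *: v] factors as
    [f v v] times the gap of the inequality. The form is only semidefinite, so both diagonal values
    may vanish; that case is separate. *)
Lemma sesquilinear_CauchySchwarz x y : `|f x y| ^+ 2 <= f x x * f y y.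
Proof.
have pos u v : 0 < f v v -> `|f u v| ^+ 2 <= f u u * f v v.
  move=> v_gt0; have := f_ge0 (f v v *: u + (- f u v) *: v).
  have vR : (f v v)^* = f v v by rewrite conj_Creal// gtr0_real.
  rewrite f_comb normrN (gtr0_norm v_gt0) rmorphN !rmorphM rmorphN/= vR !conjCK.
  rewrite (_ : _ + _ = f v v * (f u u * f v v - `|f u v| ^+ 2)).
    by rewrite (pmulr_rge0 _ v_gt0) subr_ge0.
  rewrite normCK; ring.
have := f_ge0 y; rewrite le_eqVlt => /predU1P[y0|/pos//].
have := f_ge0 x; rewrite le_eqVlt => /predU1P[x0|x_gt0].
  (* Both diagonal terms vanish, so the form at this vector is [-2 |f x y|^2], which must still be
     nonnegative. *)
  have := f_ge0 (1 *: x + (- f x y) *: y).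
  rewrite f_comb -x0 -y0 !mulr0 add0r addr0 mul1r rmorphN rmorphM rmorphN/= conjCK.
  rewrite (_ : _ + _ = - (`|f x y| ^+ 2 *+ 2)); last by rewrite normCK; ring.
  by rewrite oppr_ge0 pmulrn_lle0.
by rewrite [f x y]sesquilinear_ge0_herm norm_conjC mulrC; exact: pos.
Qed.

End positive_sesquilinear.

Local Open Scope complex_scope.

Lemma linear_fun0 (K : nzRingType) (U V : lmodType K) (f : U -> V) :
  linear f -> f 0 = 0.
Proof.
by move=> /(_ (-1) 0 0); rewrite scaler0 addr0 scaleN1r addNr.
Qed.

Lemma linear_funZ (K : nzRingType) (U V : lmodType K) (f : U -> V) :
  linear f -> forall a x, f (a *: x) = a *: f x.
Proof.
by move=> f_lin a x; rewrite -[a *: x]addr0 f_lin (linear_fun0 f_lin) addr0.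
Qed.

(** * The semi-inner product and seminorm induced by [A] *)

Section semi_inner_product.
Context {R : realType} {H : hilbertType R}.

Lemma normc_ge0 (z : R[i]) : 0 <= Normc.normc z.
Proof. by case: z => a b; exact: sqrtr_ge0. Qed.

Variable A : H -> H.
Hypothesis A_pos : positive_operator A.

Lemma innerA_linearl a x y z :
  innerA A (a *: x + y) z = a * innerA A x z + innerA A y z.
Proof. by rewrite /innerA A_pos.1.1 linearPl. Qed.

Lemma innerA_linearr a x y z :
  innerA A x (a *: y + z) = a^*%R * innerA A x y + innerA A x z.
Proof. exact: linearPr. Qed.

Lemma innerA_ge0 x : 0 <= innerA A x x.
Proof. exact: A_pos.2. Qed.

Lemma innerAC x y : innerA A y x = (innerA A x y)^*%R.
Proof.
apply: (@sesquilinear_ge0_herm R[i] H (innerA A) _ _ innerA_ge0).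
  exact: innerA_linearl.
exact: innerA_linearr.
Qed.

Lemma normA_ge0 x : 0 <= normA A x. Proof. exact: sqrtr_ge0. Qed.

Lemma sqr_normA x : (normA A x ^+ 2)%:C = innerA A x x.
Proof.
have := innerA_ge0 x; rewrite /normA.
case: (innerA A x x) => a b; rewrite lecE/= => /andP[/eqP b0 a0]; by rewrite sqr_sqrtr// b0.
Qed.

Lemma normr_normc (z : R[i]) : `|z| = (Normc.normc z)%:C.
Proof. by []. Qed.

Lemma innerA_CauchySchwarz x y :
  Normc.normc (innerA A x y) <= normA A x * normA A y.
Proof.
have := @sesquilinear_CauchySchwarz R[i] H (innerA A)
  innerA_linearl innerA_linearr innerA_ge0 x y.
rewrite -!sqr_normA normr_normc -rmorphXn -rmorphM lecR -exprMn.
by rewrite ler_sqr// nnegrE ?mulr_ge0 ?normA_ge0 ?normc_ge0.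
Qed.

Lemma inner_eq0 (x : H) : inner x x = 0 -> x = 0.
Proof. by rewrite inner_norm => /eqP; rewrite sqrf_eq0 normr_eq0 => /eqP. Qed.

(** Cauchy-Schwarz against the vector [A x], since [innerA A x (A x)] is [inner (A x) (A x)]. *)
Lemma normA_eq0 x : normA A x = 0 -> A x = 0.
Proof.
move=> x0; apply/inner_eq0/Normc.eq0_normc/eqP.
rewrite eq_le normc_ge0 andbT.
by have := innerA_CauchySchwarz x (A x); rewrite x0 mul0r.
Qed.

Lemma innerAZl a x y : innerA A (a *: x) y = a * innerA A x y.
Proof. by rewrite /innerA (linear_funZ A_pos.1.1) linearZl. Qed.

Lemma innerAZr a x y : innerA A x (a *: y) = a^*%R * innerA A x y.
Proof. by rewrite /innerA linearZr. Qed.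

Lemma innerADl x y z : innerA A (x + y) z = innerA A x z + innerA A y z.
Proof. by rewrite -[x in LHS]scale1r innerA_linearl mul1r. Qed.

Lemma innerADr x y z : innerA A x (y + z) = innerA A x y + innerA A x z.
Proof. by rewrite /innerA linearDr. Qed.

Lemma normAZ a x : normA A (a *: x) = Normc.normc a * normA A x.
Proof.
apply/eqP; rewrite -(@eqrXn2 _ 2) ?mulr_ge0 ?normA_ge0 ?normc_ge0//.
apply/eqP/complexI; rewrite sqr_normA exprMn [RHS]rmorphM/= sqr_normA innerAZl innerAZr.
by rewrite mulrA -normCK normr_normc rmorphXn.
Qed.

Lemma ler_normAD x y : normA A (x + y) <= normA A x + normA A y.
Proof.
rewrite -(@ler_pXn2r _ 2) ?nnegrE ?normA_ge0 ?addr_ge0 ?normA_ge0//.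
rewrite -lecR sqr_normA innerADl !innerADr (innerAC x y) -!sqr_normA.
rewrite sqrrD.
(* The conjugate cross terms add up to twice a real part, so the comparison descends to [R]. *)
have -> : (normA A x ^+ 2)%:C + innerA A x y
    + ((innerA A x y)^*%R + (normA A y ^+ 2)%:C) =
    (normA A x ^+ 2 + normA A y ^+ 2 + complex.Re (innerA A x y) *+ 2)%:C.
  case: (innerA A x y) => a b /=.
  by apply/eqP; rewrite eq_complex/=; apply/andP; split; apply/eqP; ring.
rewrite lecR [leRHS]addrAC lerD2l lerMn2r//.
apply: le_trans (innerA_CauchySchwarz x y).
have := normc_ge_Re (innerA A x y); rewrite normr_normc lecR.
exact/le_trans/ler_norm.
Qed.

(* On vectors with [normA A x = 0] the form vanishes since then [A x = 0]; all
   other vectors are multiples of unit ones, and polarization concludes. *)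
Lemma innerA_eq0 (B : H -> H) : linear B ->
  (forall x, normA A x = 1 -> innerA A (B x) x = 0) ->
  forall x, A (B x) = 0.
Proof.
move=> B_lin B0 x; apply: inner_eq0.
(* The goal is the value of this form at [x] and [A (B x)], so a vanishing diagonal suffices. *)
apply: (@sesquilinear_eq0 R[i] H (fun x y => innerA A (B x) y)).
- by move=> a u v w; rewrite B_lin innerA_linearl.
- by move=> a u v w; exact: innerA_linearr.
move=> u; have [u0|u_neq0] := eqVneq (normA A u) 0.
  by rewrite innerAC /innerA normA_eq0// linear0l conjC0.
have := B0 (((normA A u)^-1)%:C *: u).
have normcR (r : R) : 0 <= r -> Normc.normc r%:C = r.
  by move=> r0; rewrite /= expr0n/= addr0 sqrtr_sqr ger0_norm.
rewrite normAZ normcR ?invr_ge0 ?normA_ge0// mulVf// => /(_ erefl)/eqP.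
rewrite (linear_funZ B_lin) innerAZl innerAZr !mulf_eq0 conjC_eq0.
have /negPf -> : ((normA A u)^-1)%:C != 0.
  by rewrite fmorph_eq0 invr_eq0.
by move=> /eqP.
Qed.

End semi_inner_product.

(** * Weighted Euclidean seminorms on finite families of reals *)

Section weighted_l2.
Context {R : realType} {I : finType}.
Implicit Types w u v : I -> R.

Definition wnorm w u := Num.sqrt (\sum_i w i * u i ^+ 2).

Variable w : I -> R.
Hypothesis w_ge0 : forall i, 0 <= w i.

Lemma wsum_ge0 u : 0 <= \sum_i w i * u i ^+ 2.
Proof. by apply: sumr_ge0 => i _; rewrite mulr_ge0 ?sqr_ge0. Qed.

Lemma sqr_wnorm u : wnorm w u ^+ 2 = \sum_i w i * u i ^+ 2.
Proof. by rewrite sqr_sqrtr ?wsum_ge0. Qed.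

Lemma wnorm_ge0 u : 0 <= wnorm w u. Proof. exact: sqrtr_ge0. Qed.

Lemma wnorm_eq0 u : wnorm w u = 0 -> forall i, w i * u i ^+ 2 = 0.
Proof.
move=> u0 i; apply: (@psumr_eq0P _ _ xpredT (fun i => w i * u i ^+ 2)) => //.
  by move=> j _; rewrite mulr_ge0 ?sqr_ge0.
by rewrite -sqr_wnorm u0 expr0n.
Qed.

Lemma wnormZ c u : 0 <= c -> wnorm w (fun i => c * u i) = c * wnorm w u.
Proof.
move=> c0; rewrite -{2}(ger0_norm c0) -sqrtr_sqr /wnorm -sqrtrM ?sqr_ge0//.
by rewrite mulr_sumr; congr (Num.sqrt _); apply: eq_bigr => i _; ring.
Qed.

Lemma ler_wnorm u v : (forall i, 0 <= u i <= v i) -> wnorm w u <= wnorm w v.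
Proof.
move=> uv; apply/ler_wsqrtr/ler_sum => i _.
have /andP[u0 uvi] := uv i; rewrite ler_wpM2l// ler_sqr// nnegrE//.
exact: le_trans uvi.
Qed.

(** With [U] and [V] the two seminorms, the weighted sum of squares of [V * u i - U * v i] is
    [2 U V] times the gap. When [U] or [V] is zero, every term on the left vanishes instead. *)
Lemma wsum_mul_le u v : \sum_i w i * (u i * v i) <= wnorm w u * wnorm w v.
Proof.
have zero u' v' : wnorm w u' = 0 ->
    \sum_i w i * (u' i * v' i) <= wnorm w u' * wnorm w v'.
  move=> u0; rewrite u0 mul0r big1// => i _.
  have /eqP := wnorm_eq0 u0 i; rewrite mulf_eq0 expf_eq0/= => /orP[]/eqP->;
    by rewrite ?mul0r ?mulr0.
have [/zero//|u0] := eqVneq (wnorm w u) 0.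
have [/zero v0|v0] := eqVneq (wnorm w v) 0.
  by rewrite mulrC; under eq_bigr do rewrite [u _ * _]mulrC.
have := wsum_ge0 (fun i => wnorm w v * u i - wnorm w u * v i).
set U := wnorm w u; set V := wnorm w v.
rewrite (_ : \sum_i _ = (U * V) * (U * V - \sum_i w i * (u i * v i)) *+ 2).
  by rewrite pmulrn_lge0// pmulr_rge0 ?subr_ge0// mulr_gt0// lt_def wnorm_ge0 andbT.
have -> : \sum_i w i * (V * u i - U * v i) ^+ 2 =
    V ^+ 2 * (\sum_i w i * u i ^+ 2) + U ^+ 2 * (\sum_i w i * v i ^+ 2)
    - U * V *+ 2 * \sum_i w i * (u i * v i).
  by rewrite !mulr_sumr -big_split -sumrB/=; apply: eq_bigr => i _; ring.
by rewrite -!sqr_wnorm -/U -/V; ring.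
Qed.

Lemma ler_wnormD u v : wnorm w (fun i => u i + v i) <= wnorm w u + wnorm w v.
Proof.
rewrite -(@ler_pXn2r _ 2) ?nnegrE ?addr_ge0 ?wnorm_ge0//.
rewrite sqrrD !sqr_wnorm.
have -> : \sum_i w i * (u i + v i) ^+ 2 = \sum_i w i * u i ^+ 2 +
    (\sum_i w i * (u i * v i)) *+ 2 + \sum_i w i * v i ^+ 2.
  by rewrite -sumrMnl -!big_split; apply: eq_bigr => i _ /=; ring.
by rewrite lerD2r lerD2l lerMn2r wsum_mul_le orbT.
Qed.

End weighted_l2.

(** * The supremum seminorm on tuples of operators *)

Section norm_ab_theory.
Context {R : realType} {H : hilbertType R}.
Variable A : H -> H.
Hypothesis A_pos : positive_operator A.
Variables alpha beta : R.
Hypotheses (alpha_ge0 : 0 <= alpha) (beta_ge0 : 0 <= beta).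
Variable n : nat.
Implicit Types T S : 'I_n -> H -> H.

(* The index [inl k] stands for the term [alpha |<T_k x, x>_A|^2] and [inr k]
   for the term [beta ||T_k x||_A^2]. *)
Definition ab_weight (i : 'I_n + 'I_n) : R := if i is inl _ then alpha else beta.

Definition ab_coord T x (i : 'I_n + 'I_n) : R :=
  match i with
  | inl k => Normc.normc (innerA A (T k x) x)
  | inr k => normA A (T k x)
  end.

Definition ab_value T x : R := wnorm ab_weight (ab_coord T x).

Lemma ab_weight_ge0 i : 0 <= ab_weight i. Proof. by case: i. Qed.

Lemma ab_coord_ge0 T x i : 0 <= ab_coord T x i.
Proof. by case: i => k /=; rewrite ?normc_ge0 ?normA_ge0. Qed.

Lemma norm_abE T :
  norm_ab A alpha beta T = sup [set ab_value T x | x in [set x | normA A x = 1]].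
Proof.
congr sup; apply: eq_imagel => x _; congr Num.sqrt.
by rewrite big_sumType/= -big_split.
Qed.

Lemma ab_valueZ c T x : ab_value (c *: T) x = Normc.normc c * ab_value T x.
Proof.
rewrite /ab_value -wnormZ ?normc_ge0//.
congr wnorm; apply/funext => -[k|k] /=; last exact: normAZ.
by rewrite (innerAZl A_pos) Normc.normcM.
Qed.

Lemma ler_ab_valueD T S x : ab_value (T + S) x <= ab_value T x + ab_value S x.
Proof.
apply: le_trans (ler_wnormD ab_weight_ge0 _ _).
apply: (ler_wnorm ab_weight_ge0) => -[k|k] /=.
  by rewrite normc_ge0 (innerADl A_pos) le_normcD.
by rewrite normA_ge0 ler_normAD.
Qed.

(** Weaker than [has_sup]: it survives the case [A = 0], where there are no unit vectors and the set
    is empty. *)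
Definition ab_bounded T :=
  has_ubound [set ab_value T x | x in [set x | normA A x = 1]].

Lemma A_bounded_ab_bounded T :
  (forall k, A_bounded_operators A (T k)) -> ab_bounded T.
Proof.
move=> T_bnd.
have /choice[c cP] : forall k, exists c, forall x, normA A (T k x) <= c * normA A x.
  by move=> k; have [_ [c _ cP]] := T_bnd k; exists c.
(* At a unit vector [c k] bounds both coordinates of index [k]: the seminorm by choice of [c], the
   inner product by Cauchy-Schwarz. *)
exists (wnorm ab_weight (fun i => match i with inl k => c k | inr k => c k end)).
move=> _ [x /= x1 <-]; apply: (ler_wnorm ab_weight_ge0) => i.
rewrite ab_coord_ge0; case: i => k /=; have := cP k x; rewrite x1 mulr1 => //.
apply: le_trans; have := innerA_CauchySchwarz A_pos (T k x) x.
by rewrite x1 mulr1.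
Qed.

Lemma ab_boundedZ c T : ab_bounded T -> ab_bounded (c *: T).
Proof.
move=> [M MP]; exists (Normc.normc c * M) => _ [x x1 <-].
by rewrite ab_valueZ ler_wpM2l ?normc_ge0//; apply: MP; exists x.
Qed.

Lemma ab_value_le T x : ab_bounded T -> normA A x = 1 ->
  ab_value T x <= norm_ab A alpha beta T.
Proof. by rewrite norm_abE => T_bnd x1; apply: ub_le_sup => //; exists x. Qed.

Lemma norm_ab_ge0 T : 0 <= norm_ab A alpha beta T.
Proof.
rewrite norm_abE; set E := [set _ | _ in _].
(* On an empty or unbounded set [sup] takes its default value 0. *)
have [[[y Ey] E_ub]|/sup_out->//] := pselect (has_sup E).
apply: le_trans (ub_le_sup E_ub Ey).
by case: Ey => x _ <-; exact: wnorm_ge0.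
Qed.

(** The hypothesis [0 <= M] covers the empty set, whose [sup] is 0. *)
Lemma norm_ab_le T M : 0 <= M ->
  (forall x, normA A x = 1 -> ab_value T x <= M) -> norm_ab A alpha beta T <= M.
Proof.
move=> M0 TM; rewrite norm_abE.
set E := [set _ | _ in _]; have [->|/set0P E0] := eqVneq E set0.
  by rewrite sup0.
by apply: ge_sup => // _ [x x1 <-]; exact: TM.
Qed.

(** The inequality from left to right holds for every scalar; for [c != 0] the reverse one is the
    same bound for the scalar [c^-1] and the tuple [c *: T]. *)
Lemma norm_abZ c T : ab_bounded T ->
  norm_ab A alpha beta (c *: T) = Normc.normc c * norm_ab A alpha beta T.
Proof.
have norm_abZ_le d U : ab_bounded U ->
    norm_ab A alpha beta (d *: U) <= Normc.normc d * norm_ab A alpha beta U.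
  move=> U_bnd; apply: norm_ab_le => [|x x1].
    by rewrite mulr_ge0 ?normc_ge0 ?norm_ab_ge0.
  by rewrite ab_valueZ ler_wpM2l ?normc_ge0 ?ab_value_le.
move=> T_bnd; apply/eqP; rewrite eq_le norm_abZ_le//=.
have [->|c0] := eqVneq c 0; first by rewrite Normc.normc0 mul0r norm_ab_ge0.
have c_gt0 : 0 < Normc.normc c.
  by rewrite lt_def normc_ge0 andbT; apply: contra c0 => /eqP/Normc.eq0_normc->.
rewrite -ler_pdivlMl// -Normc.normcV.
rewrite -[in leLHS](scale1r T) -[in leLHS](mulVf c0) -scalerA.
exact/norm_abZ_le/ab_boundedZ.
Qed.

Lemma ler_norm_abD T S : ab_bounded T -> ab_bounded S ->
  norm_ab A alpha beta (T + S) <= norm_ab A alpha beta T + norm_ab A alpha beta S.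
Proof.
move=> T_bnd S_bnd; apply: norm_ab_le => [|x x1].
  by rewrite addr_ge0 ?norm_ab_ge0.
by rewrite (le_trans (ler_ab_valueD _ _ _))// lerD ?ab_value_le.
Qed.

Lemma norm_ab_eq0 T : (alpha, beta) != (0, 0) -> (forall k, linear (T k)) ->
  ab_bounded T ->
  norm_ab A alpha beta T = 0 <-> (forall k x, A (T k x) = 0).
Proof.
move=> ab0 T_lin T_bnd; split=> [T0 k|AT0].
  apply: (innerA_eq0 A_pos (T_lin k)) => x x1.
  have Tx0 : ab_value T x = 0.
    by apply/eqP; rewrite eq_le wnorm_ge0 andbT -T0 ab_value_le.
  have coord0 := wnorm_eq0 ab_weight_ge0 Tx0.
  (* One weight is nonzero. If it is [alpha], the inner product vanishes directly; if it is [beta],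
     the seminorm of [T k x] vanishes, hence [A (T k x) = 0] and the inner product with it. *)
  move: ab0; rewrite xpair_eqE negb_and => /orP[a0|b0].
    have /eqP := coord0 (inl k).
    by rewrite mulf_eq0 (negPf a0)/= expf_eq0/= => /eqP/Normc.eq0_normc.
  have /eqP := coord0 (inr k).
  rewrite mulf_eq0 (negPf b0)/= expf_eq0/= => /eqP/(normA_eq0 A_pos) ATx0.
  by rewrite /innerA ATx0 linear0l.
apply/eqP; rewrite eq_le norm_ab_ge0 andbT; apply: norm_ab_le => // x _.
rewrite /ab_value /wnorm big1 ?sqrtr0// => -[k|k] _ /=.
  by rewrite /innerA AT0 linear0l Normc.normc0 expr0n mulr0.
by rewrite /normA /innerA AT0 linear0l/= sqrtr0 expr0n mulr0.
Qed.

End norm_ab_theory.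

Unset Implicit Arguments.
Set Strict Implicit.
Set Printing Implicit Defensive.

Theorem proposition3p3 (R : realType) (H : hilbertType R)
    (H_nontrivial : exists x : H, x != 0)
    (A : H -> H) (A_pos : positive_operator A)
    (n : nat) (n_gt0 : (0 < n)%N)
    (alpha beta : R) (alpha_ge0 : 0 <= alpha) (beta_ge0 : 0 <= beta)
    (alpha_beta_neq0 : (alpha, beta) != (0, 0))
    (T S : 'I_n -> H -> H)
    (T_bounded : forall k, A_bounded_operators A (T k))
    (S_bounded : forall k, A_bounded_operators A (S k)) :
  [/\ norm_ab A alpha beta T = 0 <-> (forall k x, A (T k x) = 0),
      forall lambda : R[i],
        norm_ab A alpha beta (lambda *: T) =
        Normc.normc lambda * norm_ab A alpha beta T &
      norm_ab A alpha beta (T + S) <=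
      norm_ab A alpha beta T + norm_ab A alpha beta S].
Proof.
(* A-boundedness makes both suprema bounded above, so the default value of [sup] cannot hide an
   unbounded set. *)
have T_bnd := A_bounded_ab_bounded A_pos alpha_ge0 beta_ge0 T_bounded.
have S_bnd := A_bounded_ab_bounded A_pos alpha_ge0 beta_ge0 S_bounded.
split.
- by apply: norm_ab_eq0 => // k; have [[]] := T_bounded k.
- by move=> c; exact: norm_abZ.
- exact: ler_norm_abD.
Qed.
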